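(* For every uncountable cardinal $\kappa$, there exists a Fréchet–Urysohn minimal topological group $G$ of character $\kappa$ such that the connected component $c(G)$ of $G$ is an open normal $\omega$-bounded subgroup of $G$ (so that $G$ is locally precompact).
   Context: All topological groups are Hausdorff. A Hausdorff topological group $(G,\mathscr{T})$ is minimal if every Hausdorff group topology $\mathscr{T}'\subseteq\mathscr{T}$ on $G$ satisfies $\mathscr{T}'=\mathscr{T}$. A space $X$ is $\omega$-bounded if the closure in $X$ of every countable subset of $X$ is compact. A topological group is locally precompact if it is topologically isomorphic to a subgroup of some locally compact group. $c(G)$ is the connected component of the identity of $G$. *)

(* Defs.v *)
From HB Require Import structures.
From mathcomp Require Import all_boot.
From mathcomp Require Import all_classical topology.
Set Implicit Arguments.
Unset Strict Implicit.
Unset Printing Implicit Defensive.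
Local Open Scope classical_set_scope.
Local Open Scope card_scope.
Local Open Scope group_scope.

(* The library only has commutative (additive) topological groups. *)
HB.mixin Record Group_isTopologicalGroup G & Topological G & Group G := {
  mulg_continuous : continuous (fun z : G * G => z.1 * z.2 : G);
  invg_continuous : continuous (fun x : G => x^-1)
}.

#[short(type="topologicalGroupType")]
HB.structure Definition TopologicalGroup :=
  {G of Topological G & Group G & Group_isTopologicalGroup G}.

(* To compare several topologies on the same group, a topology other than the
   canonical one is represented by the family of its open sets. *)
Definition is_topology (T : Type) (O : set_system T) : Prop :=
  [/\ O setT,
      forall U V, O U -> O V -> O (U `&` V)
    & forall F : set_system T, F `<=` O -> O (\bigcup_(U in F) U)].

Definition is_group_topology (G : groupType) (O : set_system G) : Prop :=
  [/\ is_topology O,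
      forall (x y : G) W, O W -> W (x * y) ->
        exists U V, [/\ O U, O V, U x, V y
          & forall u v, U u -> V v -> W (u * v)]
    & forall W, O W -> O [set x | W x^-1]].

Definition is_hausdorff_topology (T : Type) (O : set_system T) : Prop :=
  forall x y : T, x <> y ->
    exists U V, [/\ O U, O V, U x, V y & U `&` V = set0].

Lemma open_is_group_topology (G : topologicalGroupType) :
  is_group_topology (open : set_system G).
Proof.
split.
- split; [exact: openT | exact: openI | move=> F sF; exact: bigcup_open].
- move=> x y W oW Wxy.
  have : nbhs ((x,y).1 * (x,y).2) W by apply: open_nbhs_nbhs.
  move=> /(@mulg_continuous G (x, y)) [[A B] /= [nA nB] sAB].
  move: nA nB; rewrite !nbhsE => -[A' [oA' A'x] sA] [B' [oB' B'y] sB].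
  exists A', B'; split=> // u v Au Bv.
  by apply: (sAB (u, v)); split; [exact: sA | exact: sB].
- by move=> W oW; apply: open_comp => // x _; exact: invg_continuous.
Qed.

Lemma hausdorff_spaceE (X : topologicalType) :
  hausdorff_space X <-> is_hausdorff_topology (open : set_system X).
Proof.
rewrite open_hausdorff; split.
  move=> h x y /eqP xy; have [[A B] /= [xA yB] [oA oB AB]] := h _ _ xy.
  by exists A, B; split=> //; [exact: set_mem|exact: set_mem|exact/eqP].
move=> h x y /eqP xy; have [U [V [oU oV Ux Vy UV]]] := h _ _ xy.
by exists (U, V); rewrite /= ?inE //; split=> //; apply/eqP.
Qed.

Definition minimal_group (G : topologicalGroupType) : Prop :=
  hausdorff_space G /\
  forall O : set_system G,
    is_group_topology O -> is_hausdorff_topology O ->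
    O `<=` open -> O = open.

Definition frechet_urysohn (X : topologicalType) : Prop :=
  forall (A : set X) (x : X), closure A x ->
    exists2 u : nat -> X, (forall n, A (u n)) & u @ \oo --> x.

Definition local_basis (X : topologicalType) (x : X) (B : set_system X) : Prop :=
  B `<=` open_nbhs x /\ filter_from B id --> x.

Definition character_le (X : topologicalType) (K : Type) : Prop :=
  forall x : X, exists2 B, local_basis x B & B #<= [set: K].

(* The character of X is the supremum of the characters of its points, i.e. the
   least cardinal bounding all of them; cardinals are represented by types. *)
Definition has_character (X : topologicalType) (K : Type) : Prop :=
  character_le X K /\
  forall L : Type, character_le X L -> [set: K] #<= [set: L].

Definition omega_bounded (X : topologicalType) : Prop :=
  forall C : set X, countable C -> compact (closure C).

Definition is_normal_subgroup (G : groupType) (N : set G) : Prop :=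
  [/\ N 1,
      forall x y, N x -> N y -> N (x * y),
      forall x, N x -> N x^-1
    & forall x y, N x -> N (x ^ y)].

Definition identity_component (G : topologicalGroupType) : set G :=
  connected_component [set: G] 1.
Arguments identity_component G : clear implicits.

(* The image of an injective homomorphism f is a subgroup; the last condition
   says that f is a homeomorphism onto it for the subspace topology. *)
Definition topological_group_embedding (G H : topologicalGroupType)
    (f : G -> H) : Prop :=
  [/\ {morph f : x y / x * y},
      injective f
    & forall U : set G, open U <-> exists2 V : set H, open V & f @^-1` V = U].

Definition locally_precompact (G : topologicalGroupType) : Prop :=
  exists H : topologicalGroupType,
    [/\ hausdorff_space H, locally_compact [set: H]
      & exists f : G -> H, topological_group_embedding f].

(* Main.v *)
From HB Require Import structures.
Require Import Defs.
From mathcomp Require Import all_boot all_order all_algebra.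
From mathcomp Require Import all_classical topology.
From mathcomp Require Import reals interval_inference normedtype trigo Rstruct.
From mathcomp Require Import ring lra.
Set Implicit Arguments.
Unset Strict Implicit.
Unset Printing Implicit Defensive.
Import Order.TTheory GRing.Theory Num.Theory.
Import numFieldNormedType.Exports.

(** The group is the Sigma-product of K copies of L = SO(3): the families in
    L^K with countable support, in the topology of pointwise convergence.

    Minimality rests on the trivial centre of L ([rpower_minimal]). Let O be a
    coarser Hausdorff group topology. The k-th coordinate subgroup is a compact
    copy of L, so O induces its usual topology there. If y tends to x for O
    and g lies in that subgroup, then y g y^-1 tends to x g x^-1; this
    conjugate again lies in the k-th copy of L and depends on y_k alone. Hence
    a cluster point c of y_k conjugates every element of L as x_k does, so
    c = x_k because the centre is trivial, and y_k tends to x_k because L is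
    compact. All coordinates are thus O-continuous, that is, O contains the
    product topology. The circle T could not serve as L: the constant
    families of square 1 form a closed normal subgroup of T^K that meets the
    Sigma-product trivially.

    The other properties hold for Sigma-products of any compact connected
    first countable group. Changing one coordinate does not leave a connected
    component, and the families obtained from x by erasing finitely many
    coordinates accumulate at 1; so the group is connected
    ([rpower_connected]), equals its identity component, and this component is
    trivially open and normal. A countable subset has all its supports in one
    countable set A of indices, and the families supported in A form a copy of
    the compact space L^A ([sigma_omega_bounded]). Countable supports also
    allow a point in the closure of a set to be approached by a sequence in it
    that controls, one after the other, all indices met by the supports involved;
    at any other index the sequence is constantly 1
    ([sigma_frechet_urysohn]). Local precompactness holds because L^K is a
    compact group.

    The character is computed in [rpower_character]. Basic neighbourhoods are
    coded by finite lists of pairs of an index and a natural number, and an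
    infinite K carries only |K| such lists ([seq_card_le]). Conversely, a
    member of a local basis at 1 restricts finitely many coordinates, whereas
    each coordinate is restricted by some member; so K is covered by finite
    sets indexed by the basis, which therefore has at least |K| members.

    Finally, SO(3) is compact and connected because every rotation is a
    product of three plane rotations ([turn_decomposition]), and its centre is
    trivial because a rotation that commutes with two quarter turns is scalar
    ([rotation_centerless]). *)
Local Open Scope classical_set_scope.
Local Open Scope card_scope.
Local Open Scope group_scope.

(** * Finite sequences over an infinite set *)

Definition inj_on T U (f : T -> U) (A : set T) (B : set U) :=
  (forall x, A x -> B (f x)) /\
  (forall x y, A x -> A y -> f x = f y -> x = y).

Lemma inj_on_card_le T U (f : T -> U) (A : set T) (B : set U) :
  inj_on f A B -> A #<= B.
Proof.
move=> [fAB fI].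
have fI' : {in A &, injective f}.
  by move=> x y /set_mem Ax /set_mem Ay; exact: fI.
apply: (card_le_trans (B := f @` A)).
  by rewrite (card_le_eqr (inj_card_eq fI')).
by apply: subset_card_le => _ [x Ax <-]; exact: fAB.
Qed.

Lemma card_le_inj_on T U (u0 : U) (A : set T) (B : set U) :
  A #<= B -> exists f : T -> U, inj_on f A B.
Proof.
move=> /card_leP[f].
exists (fun x => if pselect (A x) is left Ax
  then set_val (f (exist _ x (mem_set Ax))) else u0); split.
  by move=> x Ax; case: pselect => // Ax'; exact: set_valP.
move=> x y Ax Ay; case: pselect => // Ax'; case: pselect => // Ay'.
move=> /val_inj fxy.
have := @inj _ _ _ f _ _ (in_setT _) (in_setT _) fxy.
by move=> /(congr1 set_val).
Qed.

(** A maximal partial injection between A and B exhausts one of the two sets. *)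
Lemma card_le_total T U (A : set T) (B : set U) : A #<= B \/ B #<= A.
Proof.
pose P (G : set (T * U)) := [/\ forall x y, G (x, y) -> A x /\ B y,
  forall x y y', G (x, y) -> G (x, y') -> y = y'
  & forall x x' y, G (x, y) -> G (x', y) -> x = x'].
have [|G [[GAB Gfun Ginj] Gmax]] := @Zorn_bigcup _ P.
  move=> F FP Ftot; split.
  - by move=> x y [G FG Gxy]; have [+ _ _] := FP G FG; exact.
  - move=> x y y' [G FG Gxy] [G' FG' Gxy'].
    have [GG'|GG'] := Ftot G G' FG FG'.
      by have [_ + _] := FP G' FG'; apply; [exact: GG' Gxy | exact: Gxy'].
    by have [_ + _] := FP G FG; apply; [exact: Gxy | exact: GG' Gxy'].
  - move=> x x' y [G FG Gxy] [G' FG' Gxy'].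
    have [GG'|GG'] := Ftot G G' FG FG'.
      by have [_ _] := FP G' FG'; apply; [exact: GG' Gxy | exact: Gxy'].
    by have [_ _] := FP G FG; apply; [exact: Gxy | exact: GG' Gxy'].
have [Atot|/existsNP[a /not_implyP[Aa /forallNP Na]]] :=
  pselect (forall x, A x -> exists y, G (x, y)).
  left; have [->|/set0P[a Aa]] := eqVneq A set0; first exact: card_ge0.
  have [u0 _] := Atot a Aa.
  have [f fG] : {f : T -> U & forall x, A x -> G (x, f x)}.
    apply: (@choice _ _ (fun x y => A x -> G (x, y))) => x.
    by have [/Atot[y Gxy]|NA] := pselect (A x); [exists y | exists u0].
  apply: (@inj_on_card_le _ _ f); split=> [x /fG/GAB[]//|x y Ax Ay fxy].
  by apply: (Ginj x y (f x)); [|rewrite fxy]; exact: fG.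
have [Btot|/existsNP[b /not_implyP[Bb /forallNP Nb]]] :=
  pselect (forall y, B y -> exists x, G (x, y)).
  right.
  have [f fG] : {f : U -> T & forall y, B y -> G (f y, y)}.
    apply: (@choice _ _ (fun y x => B y -> G (x, y))) => y.
    by have [/Btot[x Gxy]|NB] := pselect (B y); [exists x | exists a].
  apply: (@inj_on_card_le _ _ f); split=> [x /fG/GAB[]//|x y Ax Ay fxy].
  by apply: (Gfun (f x)); [|rewrite fxy]; exact: fG.
exfalso; apply: (Gmax ((a, b) |` G)).
  split; last by move=> /(_ (a, b) (or_introl erefl)); exact: Na.
  by move=> x; right.
split=> [x y|x y y'|x x' y].
- by move=> [[-> ->]|/GAB].
- move=> [[Ex Ey]|Gxy] [[Ex' Ey']|Gxy']; first by rewrite Ey Ey'.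
  + by rewrite Ex in Gxy'; case: (Na y').
  + by rewrite Ex' in Gxy; case: (Na y).
  + exact: Gfun Gxy Gxy'.
- move=> [[Ex Ey]|Gxy] [[Ex' Ey']|Gxy']; first by rewrite Ex Ex'.
  + by rewrite Ey in Gxy'; case: (Nb x').
  + by rewrite Ey' in Gxy; case: (Nb x).
  + exact: Ginj Gxy Gxy'.
Qed.

Definition seq_in (T : choiceType) (D : set T) (s : seq (T * nat)) :=
  forall p, p \in s -> D p.1.

Lemma map_inj_on (T U : eqType) (f : T -> U) (A : set T) (B : set U) s t :
  inj_on f A B -> (forall p, p \in s -> A p) ->
  (forall p, p \in t -> A p) -> map f s = map f t -> s = t.
Proof.
move=> [_ fI]; elim: s t => [|x s IH] [|y t] //= sA tA [fxy fst].
have -> : x = y by apply: fI => //; [apply: sA|apply: tA]; exact: mem_head.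
by rewrite (IH t) // => p ps; [apply: sA|apply: tA]; rewrite inE ps orbT.
Qed.

(** An injection of the nonempty sequences over a subset A of T into A, given
    by its graph. The set A is not a separate datum but is recovered from the
    domain, so that extension of codings is mere inclusion of graphs and the
    union of a chain is again a graph of this kind. *)
Definition self_codes (T : choiceType) (G : set (seq (T * nat) * T)) :=
  let A := [set k | exists s y n, G (s, y) /\ (k, n) \in s] in
  [/\ forall s y y', G (s, y) -> G (s, y') -> y = y',
      forall s s' y, G (s, y) -> G (s', y) -> s = s',
      forall s y, G (s, y) -> A y
    & forall s, s <> [::] -> seq_in A s -> exists y, G (s, y)].

(** Take a maximal graph G as above, with underlying set A. If A embeds in its
    complement with image h(A), then the sequences over the union of A and
    h(A) that are new can be sent injectively into h(A), contradicting
    maximality. So the complement of A embeds in A, and then the sequences over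
    T are coded by sequences over A: the parity of the numerical labels records
    on which side of A each entry was. *)
Lemma seq_card_le (T : choiceType) :
  infinite_set [set: T] -> [set: seq (T * nat)] #<= [set: T].
Proof.
move=> Tinf; have [t0 _] := infinite_setN0 Tinf.
have [|G [[Gfun Ginj GA Gall] Gmax]] := @Zorn_bigcup _ (@self_codes T).
  move=> F FP Ftot.
  have Fcom G G' : F G -> F G' -> exists H, [/\ F H, G `<=` H & G' `<=` H].
    move=> FG FG'; have [GG'|GG'] := Ftot _ _ FG FG'.
      by exists G'; split.
    by exists G; split.
  split.
  - move=> s y y' [G FG Gxy] [G' FG' Gxy'].
    have [H [FH GH GH']] := Fcom _ _ FG FG'; have [+ _ _ _] := FP _ FH.
    by apply; [exact: GH Gxy | exact: GH' Gxy'].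
  - move=> s y y' [G FG Gxy] [G' FG' Gxy'].
    have [H [FH GH GH']] := Fcom _ _ FG FG'; have [_ + _ _] := FP _ FH.
    by apply; [exact: GH Gxy | exact: GH' Gxy'].
  - move=> s y [G FG Gsy]; have [_ _ GA _] := FP _ FG.
    have [s' [y' [n [Gs'y' ys']]]] := GA _ _ Gsy.
    by exists s', y', n; split=> //; exists G.
  - move=> s s0 sA.
    suff [G FG Gs] : exists2 G, F G &
        seq_in [set k | exists s y n, G (s, y) /\ (k, n) \in s] s.
      have [_ _ _ Gall] := FP _ FG.
      by have [y Gsy] := Gall s s0 Gs; exists y; exists G.
    elim: s s0 sA => // p [|q s] IH _ sA.
      have [s [y [n [[G FG Gsy] ps]]]] := sA p (mem_head _ _).
      by exists G => // _ /[!inE]/eqP->; exists s, y, n; case: p ps {sA}.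
    have [//|r rs|G FG Gqs] := IH; first by apply: sA; rewrite inE rs orbT.
    have [s' [y [n [[G' FG' Gsy] ps]]]] := sA p (mem_head _ _).
    have [H [FH GH GH']] := Fcom _ _ FG FG'.
    exists H => // u; rewrite inE => /predU1P[->|us].
      by exists s', y, n; split=> //; exact: GH'.
    have [s'' [y' [m [Gs'y' ys']]]] := Gqs _ us.
    by exists s'', y', m; split=> //; exact: GH.
set A := [set k | exists s y n, G (s, y) /\ (k, n) \in s] in GA Gall.
have GsA s y : G (s, y) -> seq_in A s.
  by move=> Gsy [k n] kn; exists s, y, n.
(* Maximality: new sequences, over a larger set, cannot be coded in the added
   part. *)
have noext (B : set T) (g : seq (T * nat) -> T) : B !=set0 -> B `<=` ~` A ->
    inj_on g (seq_in (A `|` B)) B -> False.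
  move=> [b Bb] BA [gB gI].
  pose N := [set p | [/\ p.1 <> [::], seq_in (A `|` B) p.1,
    ~ seq_in A p.1 & p.2 = g p.1]].
  have NB s y : N (s, y) -> B y by move=> [/= _ sAB _ ->]; exact: gB.
  have Nb n : N ([:: (b, n)], g [:: (b, n)]).
    split=> //=; first by move=> _ /[!inE]/eqP->; right.
    by move=> /(_ (b, n) (mem_head _ _)); exact: BA.
  apply: (Gmax (G `|` N)).
    split; first by move=> x; left.
    move=> /(_ _ (or_intror (Nb 0%N))) /GsA /(_ (b, 0%N) (mem_head _ _)).
    exact: BA.
  have AE : [set k | exists s y n, (G `|` N) (s, y) /\ (k, n) \in s]
      = A `|` B.
    apply/seteqP; split=> k.
      move=> [s [y [n [[Gsy|[/= _ sAB _ _]] ks]]]].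
        by left; apply: (GsA _ _ Gsy _ ks).
      exact: (sAB _ ks).
    move=> [[s [y [n [Gsy ks]]]]|Bk]; first by exists s, y, n; split=> //; left.
    exists [:: (k, 0%N)], (g [:: (k, 0%N)]), 0%N; split; last exact: mem_head.
    right; split=> //=; first by move=> _ /[!inE]/eqP->; right.
    by move=> /(_ (k, 0%N) (mem_head _ _)); exact: BA.
  rewrite /self_codes AE; split.
  - move=> s y y' [Gsy|[/= _ _ NA ->]] [Gsy'|[/= _ _ NA' ->]] //.
    + exact: Gfun Gsy Gsy'.
    + by case: NA'; exact: GsA Gsy.
    + by case: NA; exact: GsA Gsy'.
  - move=> s s' y [Gsy|Ny] [Gsy'|Ny'] //.
    + exact: Ginj Gsy Gsy'.
    + by case: (BA _ (NB _ _ Ny')); exact: GA Gsy.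
    + by case: (BA _ (NB _ _ Ny)); exact: GA Gsy'.
    + by case: Ny Ny' => /= _ ? _ -> [/= _ ? _]; exact: gI.
  - by move=> s y [/GA|/NB]; [left|right].
  - move=> s s0 sAB; have [/(Gall s s0)[y Gsy]|NA] := pselect (seq_in A s).
      by exists y; left.
    by exists (g s); right.
(* If A is empty, a countably infinite subset of T codes the sequences over
   itself. *)
have [A0|/set0P[a Aa]] := eqVneq A set0.
  exfalso; have [f [_ fI]] := card_le_inj_on t0 ((infiniteP _).1 Tinf).
  have [c [_ cI]] := card_le_inj_on 0%N (countableP [set: seq (nat * nat)]).
  have fR x : range f x -> exists n, f n = x by move=> [n _ <-]; exists n.
  have [h hK] : {h : T -> nat & forall x, range f x -> f (h x) = x}.
    apply: (@choice _ _ (fun x n => range f x -> f n = x)) => x.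
    by have [/fR[n]|] := pselect (range f x); [exists n | exists 0%N].
  pose e (p : T * nat) := (h p.1, p.2).
  apply: (noext (range f) (fun s => f (c (map e s)))).
  - by exists (f 0%N); exists 0%N.
  - by rewrite A0 setC0.
  rewrite A0 set0U; split=> [s _|s t sB tB]; first by eexists.
  move=> /(fI _ _ I I)/(cI _ _ I I).
  apply: (@map_inj_on _ _ _ [set p | range f p.1] setT) => //.
  split=> // -[x n] [y m] /= xB yB [hxy ->].
  by rewrite -(hK x) // hxy hK.
(* Prefixing with (a, 0) makes every sequence nonempty, as G requires. *)
have code (D : set T) (h : T -> T) : inj_on h (D `\` A) A ->
    exists g, inj_on g (seq_in D) A.
  move=> [hA hI].
  pose e (p : T * nat) := if pselect (A p.1) then (p.1, p.2.*2)
    else (h p.1, p.2.*2.+1).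
  have eA p : D p.1 -> A (e p).1.
    by move=> Dp; rewrite /e; case: pselect => //= NA; exact: hA.
  have eI : inj_on e [set p | D p.1] setT.
    split=> // -[x n] [y m] /= Dx Dy; rewrite /e.
    case: pselect => /= Ax; case: pselect => /= Ay [].
    - by move=> -> /double_inj ->.
    - by move=> _ E; have := congr1 odd E; rewrite /= !odd_double.
    - by move=> _ E; have := congr1 odd E; rewrite /= !odd_double.
    - by move=> /hI -> // /double_inj ->.
  have cA s : seq_in D s -> seq_in A ((a, 0%N) :: map e s).
    by move=> sD u; rewrite inE => /predU1P[->//|/mapP[p ps ->]]; apply/eA/sD.
  have [g gG] : {g : seq (T * nat) -> T &
      forall s, seq_in D s -> G ((a, 0%N) :: map e s, g s)}.
    apply: (@choice _ _ (fun s y => seq_in D s -> G (_ :: map e s, y))) => s.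
    have [sD|ND] := pselect (seq_in D s); last by exists t0.
    by have [//|y Gy] := Gall _ _ (cA _ sD); exists y.
  exists g; split=> [s /gG/GA //|s t sD tD gst].
  have Gs := gG s sD; have Gt := gG t tD; rewrite -gst in Gt.
  have [est] := Ginj _ _ _ Gs Gt.
  by move: est; apply: (map_inj_on eI).
have [AC|CA] := card_le_total A (~` A); last first.
  have [h hI] := card_le_inj_on a CA.
  have [|g [gA gI]] := code setT h; first by rewrite setTD.
  by apply: (@inj_on_card_le _ _ g); split=> // x y _ _; exact: gI.
(* Here A embeds by h in its complement: sequences over A and h(A) are coded in
   A, hence by h in h(A). *)
exfalso; have [h [hA hI]] := card_le_inj_on a AC.
have [h' hK] : {h' : T -> T & forall x, (h @` A) x -> A (h' x) /\ h (h' x) = x}.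
  apply: (@choice _ _ (fun x n => (h @` A) x -> A n /\ h n = x)) => x.
  by have [[n An <-]|] := pselect ((h @` A) x); [exists n | exists t0].
have [|g [gA gI]] := code (A `|` h @` A) h'.
  split=> [x [[//|/hK[]//]]|x y [[//|/hK[_ hx]] _] [[//|/hK[_ hy]] _] hxy].
  by rewrite -hx hxy.
apply: (noext (h @` A) (h \o g)).
- by exists (h a), a.
- by move=> _ [x Ax <-]; exact: hA.
- split=> [s /gA gs|s t sD tD /= /hI E]; first by exists (g s).
  by apply: gI => //; apply: E; exact: gA.
Qed.

(** * Powers of a topological group with restricted supports *)

Lemma continuous_mulg (T : topologicalType) (G : topologicalGroupType)
    (f g : T -> G) :
  continuous f -> continuous g -> continuous (fun t => f t * g t).
Proof.
move=> fc gc t; apply: (@continuous_comp _ _ _ (fun t => (f t, g t))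
  (fun z : G * G => z.1 * z.2)); last exact: mulg_continuous.
by apply: (cvg_pair (fc t) (gc t)).
Qed.

Lemma cvg_initialP (S : choiceType) (T : topologicalType) (f : S -> T)
    (F : set_system S) (x : S) : Filter F ->
  F --> (x : initial_topology f) <-> f @ F --> f x.
Proof.
move=> FF; split=> [Fx|fFx].
  exact: cvg_trans (cvg_app f Fx) (@initial_continuous _ _ f x).
move=> U [_ [[W oW <-] Wx] WU]; rewrite nbhs_filterE; apply: filterS WU _.
by apply: fFx; exact: open_nbhs_nbhs.
Qed.

Lemma ptws_cvgP (K : Type) (T : topologicalType) (F : set_system (K -> T))
    (f : {ptws K -> T}) : Filter F ->
  F --> f <-> forall k, (fun g => g k) @ F --> f k.
Proof.
move=> FF; rewrite cvg_sup; split=> H k.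
  by have /cvg_initialP := H k; apply.
by apply/cvg_initialP; exact: H.
Qed.

(** Restricting supports to an ideal of small sets of indices yields the
    Sigma-product (countable sets) and the full power (all sets) by the same
    construction, so that one proof serves for both. *)
Record support_ideal (K : Type) := SupportIdeal {
  small : set (set K);
  small_finite : forall A, finite_set A -> small A;
  smallU : forall A B, small A -> small B -> small (A `|` B);
  smallS : forall A B, A `<=` B -> small B -> small A }.

Definition supp K (L : groupType) (x : K -> L) := [set k | x k <> 1].

Record restricted_power (K : choiceType) (I : support_ideal K)
    (L : topologicalGroupType) := RestrictedPower {
  coords :> K -> L;
  small_supp : small I (supp coords) }.

Section RestrictedPower.
Variables (K : choiceType) (I : support_ideal K) (L : topologicalGroupType).
Local Notation G := (restricted_power I L).
Implicit Types (x y z : G) (k : K).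

Lemma rpower_ext x y : x =1 y -> x = y.
Proof.
case: x y => [x xI] [y yI] /= /funext xy; rewrite xy in xI *.
by congr RestrictedPower; exact: Prop_irrelevance.
Qed.

HB.instance Definition _ := gen_eqMixin G.
HB.instance Definition _ := gen_choiceMixin G.

Lemma rpower_one_subproof : small I (supp (fun _ : K => 1 : L)).
Proof.
by apply: small_finite; rewrite (_ : supp _ = set0) // -subset0 => k /(_ erefl).
Qed.

Lemma rpower_inv_subproof x : small I (supp (fun k => (x k)^-1)).
Proof.
apply: smallS (small_supp x) => k /= xk1 xk; apply: xk1.
by rewrite xk invg1.
Qed.

Lemma rpower_mul_subproof x y : small I (supp (fun k => x k * y k)).
Proof.
apply: smallS (smallU (small_supp x) (small_supp y)) => k /= xyk.
have [xk|] := pselect (x k = 1); last by left.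
by right=> yk; apply: xyk; rewrite xk yk mulg1.
Qed.

Definition rpower_one := RestrictedPower rpower_one_subproof.
Definition rpower_inv x := RestrictedPower (rpower_inv_subproof x).
Definition rpower_mul x y := RestrictedPower (rpower_mul_subproof x y).

Lemma rpower_mulA : associative rpower_mul.
Proof. by move=> x y z; apply: rpower_ext => k /=; exact: mulgA. Qed.
Lemma rpower_mul1 : left_id rpower_one rpower_mul.
Proof. by move=> x; apply: rpower_ext => k /=; exact: mul1g. Qed.
Lemma rpower_mul1r : right_id rpower_one rpower_mul.
Proof. by move=> x; apply: rpower_ext => k /=; exact: mulg1. Qed.
Lemma rpower_mulV : left_inverse rpower_one rpower_inv rpower_mul.
Proof. by move=> x; apply: rpower_ext => k /=; exact: mulVg. Qed.
Lemma rpower_mulVr : right_inverse rpower_one rpower_inv rpower_mul.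
Proof. by move=> x; apply: rpower_ext => k /=; exact: mulgV. Qed.

HB.instance Definition _ := isGroup.Build G
  rpower_mulA rpower_mul1 rpower_mul1r rpower_mulV rpower_mulVr.

HB.instance Definition _ := Topological.copy G
  (initial_topology (@coords K I L : G -> {ptws K -> L})).

Lemma rpower_cvgP (F : set_system G) x : Filter F ->
  F --> x <-> forall k, (fun y => y k) @ F --> x k.
Proof.
move=> FF; rewrite -[F --> x]/(F --> (x : initial_topology _)) cvg_initialP.
exact: ptws_cvgP.
Qed.

Lemma rpower_coord_continuous k : continuous (fun x : G => x k).
Proof. by move=> x; have /rpower_cvgP := @cvg_id _ (nbhs x); apply. Qed.

Lemma rpower_continuousP (T : topologicalType) (f : T -> G) :
  (forall k, continuous (fun t => f t k)) -> continuous f.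
Proof. by move=> fc t; apply/rpower_cvgP => k; exact: fc. Qed.

Lemma rpower_mul_continuous : continuous (fun z : G * G => z.1 * z.2 : G).
Proof.
apply: rpower_continuousP => k z.
apply: (@continuous_comp _ _ _ (fun z : G * G => (z.1 k, z.2 k))
  (fun w : L * L => w.1 * w.2)); last exact: mulg_continuous.
apply: cvg_pair => /=.
  by apply: (@cvg_comp _ _ _ fst (fun x : G => x k) _ (nbhs z.1));
    [exact: cvg_fst | exact: rpower_coord_continuous].
by apply: (@cvg_comp _ _ _ snd (fun x : G => x k) _ (nbhs z.2));
  [exact: cvg_snd | exact: rpower_coord_continuous].
Qed.

Lemma rpower_inv_continuous : continuous (fun x : G => x^-1).
Proof.
apply: rpower_continuousP => k x.
apply: (@continuous_comp _ _ _ (fun x : G => x k) (fun w : L => w^-1)).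
  exact: rpower_coord_continuous.
exact: invg_continuous.
Qed.

HB.instance Definition _ :=
  Group_isTopologicalGroup.Build G rpower_mul_continuous rpower_inv_continuous.

Lemma rpowerM x y k : (x * y) k = x k * y k. Proof. by []. Qed.
Lemma rpowerV x k : x^-1 k = (x k)^-1. Proof. by []. Qed.
Lemma rpower1 k : (1 : G) k = 1. Proof. by []. Qed.

Lemma rpower_hausdorff : hausdorff_space L -> hausdorff_space G.
Proof.
move=> hL x y xy; apply: rpower_ext => k; apply: hL => A B Ax By.
have [z [Az Bz]] :=
  xy _ _ (rpower_coord_continuous Ax) (rpower_coord_continuous By).
by exists (z k).
Qed.

Lemma override_subproof (A : set K) (f : K -> L) x :
  small I A -> small I (supp (fun k => if `[< A k >] then f k else x k)).
Proof.
move=> As; apply: smallS (smallU As (small_supp x)) => k /=.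
by rewrite /supp /=; case: asboolP => [Ak _|_ xk]; [left|right].
Qed.

Definition override (A : set K) (As : small I A) (f : K -> L) x : G :=
  RestrictedPower (override_subproof f x As).

Lemma override_continuous (A : set K) (As : small I A) x :
  continuous ((fun f => override As f x) : {ptws K -> L} -> G).
Proof.
apply: rpower_continuousP => k f /=.
case: asboolP => Ak; last exact: cst_continuous.
have /ptws_cvgP : nbhs f --> f by exact: cvg_id.
exact.
Qed.

End RestrictedPower.

(** * Minimality *)

Lemma compact_unique_cluster_cvg (T : topologicalType) (F : set_system T) (x : T) :
  hausdorff_space T -> compact [set: T] -> ProperFilter F ->
  (forall c, cluster F c -> c = x) -> F --> x.
Proof.
move=> hT cT FF Fx; have FT : F setT by exact: filterT.
apply: (compact_cluster_set1 hT cT) => //; first exact: filterT.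
have [c [_ Fc]] := cT F FF FT.
apply/seteqP; split=> [d /Fx //|d ->].
by rewrite -(Fx c).
Qed.

Section OpenSets.
Variables (T : Type) (O : set_system T).
Hypothesis Otop : is_topology O.

(** The neighbourhood filters of a topology that is given by its open sets and
    is not the canonical one of its carrier. *)
Definition nbhs_of (x : T) : set_system T :=
  [set A | exists U, [/\ O U, U x & U `<=` A]].

Lemma nbhs_of_filter x : ProperFilter (nbhs_of x).
Proof.
have [OT OI OU] := Otop; apply: Build_ProperFilter_ex.
  by move=> A [U [_ Ux UA]]; exists x; exact: UA.
split.
- by exists setT; split.
- move=> A B [U [OU1 Ux UA]] [V [OV Vx VB]]; exists (U `&` V); split=> //.
    exact: OI.
  by move=> y [/UA Ay /VB By].
- by move=> A B AB [U [OU1 Ux UA]]; exists U; split=> // y /UA /AB.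
Qed.

Lemma open_nbhs_of (W : set T) : (forall x, W x -> nbhs_of x W) -> O W.
Proof.
move=> Wn; have [_ _ OU] := Otop.
rewrite (_ : W = \bigcup_(U in [set U | O U /\ U `<=` W]) U).
  by apply: OU => U [].
apply/seteqP; split=> [x /Wn[U [OU' Ux UW]]|x [U [_ UW] /UW//]].
by exists U.
Qed.

End OpenSets.

Section Minimal.
Variables (K : choiceType) (I : support_ideal K) (L : topologicalGroupType).
Local Notation G := (restricted_power I L).
Implicit Types (x y z : G) (k : K).

Lemma small1 k : small I [set k].
Proof. exact: small_finite. Qed.

Definition update k x (g : L) : G := override (small1 k) (fun=> g) x.

Lemma update_same k x g : update k x g k = g.
Proof. by rewrite /update /=; case: asboolP. Qed.

Lemma update_other k x g j : j <> k -> update k x g j = x j.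
Proof. by rewrite /update /=; case: asboolP. Qed.

Lemma update_continuous k x : continuous (update k x).
Proof.
apply: rpower_continuousP => j; have [->|/eqP jk] := eqVneq j k.
  by under eq_fun do rewrite update_same; move=> t; exact: cvg_id.
by under eq_fun do rewrite update_other //; exact: cst_continuous.
Qed.

Arguments update : simpl never.
Local Notation insert k := (update k 1).

(** Conjugation of an element of the k-th coordinate subgroup by y stays in
    that subgroup and depends on the k-th coordinate of y only: through this
    action any group topology sees the single coordinate y_k. *)
Lemma conj_insert k y g : y * insert k g * y^-1 = insert k (y k * g * (y k)^-1).
Proof.
apply: rpower_ext => j; rewrite rpowerM rpowerM rpowerV.
have [->|/eqP jk] := eqVneq j k; first by rewrite !update_same.
by rewrite !update_other // rpower1 mulg1 mulgV.
Qed.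

(** Compactness is used twice in the same way: in a compact Hausdorff space a
    filter with a single cluster point converges. *)
Theorem rpower_minimal : hausdorff_space L -> compact [set: L] ->
  (forall x : L, x <> 1 -> exists g, x * g <> g * x) -> minimal_group G.
Proof.
move=> hL cL Z1; split; first exact: rpower_hausdorff.
move=> O [Otop Omul Oinv] Ohaus Oopen; apply/seteqP; split=> // W oW.
have Onb x : ProperFilter (nbhs_of O x) by exact: nbhs_of_filter.
(* O induces the topology of L on each coordinate subgroup, since a cluster
   point there could be separated by O. *)
have ins_cvg k g P : nbhs g P ->
    exists U, [/\ O U, U (insert k g) & forall h, U (insert k h) -> P h].
  pose F : set_system L := [set A | exists U,
    [/\ O U, U (insert k g) & forall h, U (insert k h) -> A h]].
  suff: F --> g by move=> /(_ P); exact.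
  have FF : ProperFilter F.
    apply: Build_ProperFilter_ex.
      by move=> A [U [_ Ug UA]]; exists g; exact: UA.
    split.
    - by exists setT; split=> //; case: Otop.
    - move=> A B [U [OU Ug UA]] [V [OV Vg VB]].
      exists (U `&` V); split=> //; first by case: Otop => _ + _; apply.
      by move=> h [/UA + /VB].
    - move=> A B AB [U [OU Ug UA]].
      by exists U; split=> // h /UA /AB.
  apply: compact_unique_cluster_cvg => // c Fc; apply: contrapT => cg.
  have /Ohaus[U [V [OU OV Uc Vg UV]]] : insert k c <> insert k g.
    by move=> /(congr1 (fun x : G => x k)); rewrite !update_same.
  have [||h [Vh Uh]] := Fc [set h | V (insert k h)] [set h | U (insert k h)].
  - by exists V; split.
  - apply: (@update_continuous k 1 c U); apply: open_nbhs_nbhs.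
    by split=> //; exact: Oopen.
  by have : set0 (insert k h) by rewrite -UV.
(* A cluster point c <> x_k of the k-th coordinate would act by conjugation
   differently from x_k on some g, as x_k^-1 c is not central. *)
have coord_cvg x k : (fun y => y k) @ nbhs_of O x --> x k.
  apply: compact_unique_cluster_cvg => // c Fc; apply: contrapT => cx.
  have [|g cg] := Z1 ((x k)^-1 * c).
    by move=> /(congr1 (fun h => x k * h)); rewrite mulVKg mulg1.
  have Ncg : x k * g * (x k)^-1 <> c * g * c^-1.
    move=> /(congr1 (fun h => (x k)^-1 * h * c)).
    rewrite -!mulgA mulKg mulVg mulg1 => E.
    by apply: cg; rewrite -!mulgA E.
  have /hausdorff_spaceE/(_ _ _ Ncg)[P [Q [oP oQ Pg Qg PQ]]] := hL.
  have [|U [OU Ug UP]] := @ins_cvg k (x k * g * (x k)^-1) P.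
    exact: open_nbhs_nbhs.
  rewrite -conj_insert in Ug.
  have [U1 [V1 [OU1 OV1 U1x V1x U1V1]]] := Omul _ _ _ OU Ug.
  have [U2 [V2 [OU2 OV2 U2x V2g U2V2]]] := Omul _ _ _ OU1 U1x.
  have OV1' := Oinv _ OV1.
  pose conjg_by (h : L) := h * g * h^-1.
  have conjC : continuous conjg_by.
    apply: (continuous_mulg (f := fun h => h * g)); last exact: invg_continuous.
    by apply: continuous_mulg; [move=> h; exact: cvg_id | exact: cst_continuous].
  have [||h [/= [y [U2y V1y] <-] Qy]] := Fc
      ((fun y : G => y k) @` (U2 `&` [set y | V1 y^-1])) (conjg_by @^-1` Q).
  - exists (U2 `&` [set y | V1 y^-1]); split=> //.
    + by case: Otop => _ + _; apply.
    + by move=> y Hy; exists y.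
  - by apply: conjC; exact: open_nbhs_nbhs.
  have Uy : U (y * insert k g * y^-1) by apply: U1V1 => //; exact: U2V2.
  rewrite conj_insert in Uy.
  by have : set0 (conjg_by (y k)) by rewrite -PQ; split=> //; exact: UP.
apply: (open_nbhs_of Otop) => x Wx.
have /rpower_cvgP Ox := fun k => coord_cvg x k.
by apply: Ox; exact: open_nbhs_nbhs.
Qed.

End Minimal.
Arguments update : simpl never.

(** * Connectedness, omega-boundedness and local precompactness *)

Section Connected.
Variables (K : choiceType) (I : support_ideal K) (L : topologicalGroupType).
Local Notation G := (restricted_power I L).
Implicit Types (x y z : G) (k : K).

Definition erase (s : seq K) x : G := foldr (fun k y => update k y 1) x s.

Lemma eraseE s x k : erase s x k = if k \in s then 1 else x k.
Proof.
elim: s => [//|j s IH]; rewrite -[erase _ x]/(update j (erase s x) 1) inE.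
have [->|/eqP kj] := eqVneq k j; first by rewrite update_same.
by rewrite update_other.
Qed.

(** The component of x contains every [erase s x]; along the filter of large s
    these tend to 1, so 1 lies in the closure of that component. *)
Lemma rpower_connected : connected [set: L] -> connected [set: G].
Proof.
move=> cL; suff <- : connected_component [set: G] 1 = setT.
  exact: component_connected.
apply/seteqP; split=> // x _; apply: connected_component_sym.
have upd y k g : connected_component [set: G] y (update k y g).
  exists (range (update k y)); last by exists g.
  split=> //; first by exists (y k) => //; apply: rpower_ext => j;
    have [->|/eqP jk] := eqVneq j k; rewrite ?update_same ?update_other.
  apply: connected_continuous_connected => //.
  by apply: continuous_subspaceT => ?; exact: update_continuous.
have ers s : connected_component [set: G] x (erase s x).
  elim: s => [|k s IH]; first exact: connected_component_refl.
  exact: connected_component_trans IH (upd _ _ _).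
have clos : connected (closure (connected_component [set: G] x)).
  by apply: connected_closure; exact: component_connected.
have xcl : closure (connected_component [set: G] x) x.
  by apply: subset_closure; exact: connected_component_refl.
apply: (connected_component_max xcl _ clos) => //.
pose F : set_system G :=
  [set A | exists s : seq K, forall t, {subset s <= t} -> A (erase t x)].
have FF : Filter F.
  split; first by exists [::].
  - move=> A B [s sA] [t tB]; exists (s ++ t) => u stu; split.
      by apply: sA => k ks; apply: stu; rewrite mem_cat ks.
    by apply: tB => k ks; apply: stu; rewrite mem_cat ks orbT.
  - by move=> A B AB [s sA]; exists s => t /sA /AB.
have F1 : F --> (1 : G).
  apply/rpower_cvgP => k U /nbhs_singleton U1.
  exists [:: k] => t kt; rewrite /= eraseE kt ?mem_head //.
move=> U /F1 [s /(_ s) sU]; exists (erase s x); split; first exact: ers.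
exact: sU.
Qed.

End Connected.

Section Compact.
Variables (K : choiceType) (I : support_ideal K) (L : topologicalGroupType).
Local Notation G := (restricted_power I L).

(** These families form the image of L^K under the continuous map that replaces
    the coordinates outside A by 1. *)
Lemma supp_in_compact A : small I A -> compact [set: L] ->
  compact [set x : G | supp x `<=` A].
Proof.
move=> As cL.
pose f (h : {ptws K -> L}) : G := override As h 1.
have -> : [set x : G | supp x `<=` A] =
    f @` [set h : {ptws K -> L} | forall k, [set: L] (h k)].
  apply/seteqP; split=> [x xA|_ [h _ <-] k /=].
    exists x => //; apply: rpower_ext => k /=; case: asboolP => // Ak.
    by apply: contrapT => xk; apply: Ak; apply: xA => E; exact: xk.
  by rewrite /supp /=; case: asboolP.
apply: continuous_compact; last exact: (@tychonoff K (fun=> L) (fun=> setT)).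
by apply: continuous_subspaceT => ?; exact: override_continuous.
Qed.

End Compact.

Definition countable_supports (K : Type) : support_ideal K.
Proof.
exists (fun A => countable A : Prop).
- exact: finite_set_countable.
- move=> A B cA cB; rewrite -bigcup2E; apply: bigcup_countable => //.
  by move=> [|[|n]] _ //=; exact: countable0.
- by move=> A B AB; apply: sub_countable; exact: subset_card_le.
Defined.

Definition all_supports (K : Type) : support_ideal K.
Proof. by exists (fun=> True). Defined.

Lemma sigma_omega_bounded (K : choiceType) (L : topologicalGroupType) :
  hausdorff_space L -> compact [set: L] ->
  omega_bounded (restricted_power (countable_supports K) L).
Proof.
move=> hL cL C cC; pose A := \bigcup_(x in C)
  supp (x : restricted_power (countable_supports K) L).
have cA : countable A.
  by apply: bigcup_countable => // x _; exact: (small_supp x).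
have cpt := @supp_in_compact K (countable_supports K) L A cA cL.
have /closure_id clB := compact_closed (rpower_hausdorff hL) cpt.
apply: (subclosed_compact _ cpt); first exact: closed_closure.
by rewrite clB; apply: closureS => x Cx k xk; exists x.
Qed.

(** The type of points of the full set is homeomorphic, but not identical, to
    the space. *)
Lemma omega_bounded_subspaceT (X : topologicalType) (A : set X) :
  A = setT -> omega_bounded X -> omega_bounded A.
Proof.
move=> -> oX C cC.
pose f (x : X) : [set: X] := exist _ x (mem_set (I : setT x)).
have fc : continuous f.
  by move=> x; apply/cvg_initialP; exact: cvg_id.
have fK (y : [set: X]) : f (set_val y) = y by exact: val_inj.
have vc : continuous (set_val : [set: X] -> X) by exact: initial_continuous.
have cfC : compact (f @` closure (set_val @` C)).
  apply: continuous_compact; first by apply: continuous_subspaceT => ?; exact: fc.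
  by apply: oX; apply: sub_countable cC; exact: card_image_le.
apply: subclosed_compact cfC _; first exact: closed_closure.
move=> y Cy; exists (set_val y) => // U /vc /Cy[z [Cz Uz]].
by exists (set_val z); split => //; exists z.
Qed.

Lemma rpower_locally_precompact (K : choiceType) (I : support_ideal K)
    (L : topologicalGroupType) :
  hausdorff_space L -> compact [set: L] ->
  locally_precompact (restricted_power I L).
Proof.
move=> hL cL.
pose H : topologicalGroupType := restricted_power (all_supports K) L.
have small_all (x : K -> L) : small (all_supports K) (supp x) by [].
exists H; split.
- exact: rpower_hausdorff.
- move=> x _; exists setT; first exact: filterT.
  split=> //.
  have := @supp_in_compact K (all_supports K) L setT Logic.I cL.
  by congr compact; apply/seteqP; split.
- exists (fun x : restricted_power I L => RestrictedPower (small_all x) : H).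
  split.
  + by move=> x y; exact: rpower_ext.
  + move=> x y xy; apply: rpower_ext => k.
    by have := congr1 (fun x : H => x k) xy.
  + move=> U; split=> [[W oW <-]|[V [W oW <-] <-]]; last by exists W.
    by exists (@coords K (all_supports K) L @^-1` W) => //; exists W.
Qed.

(** * The Frechet-Urysohn property and the character *)

Definition decreasing_bases (X : topologicalType) (b : X -> nat -> set X) :=
  (forall x n, open_nbhs x (b x n)) /\
  (forall x U, nbhs x U -> exists n, forall m, (n <= m)%N -> b x m `<=` U).

Section FrechetUrysohn.
Variables (K : choiceType) (L : topologicalGroupType).
Local Notation G := (restricted_power (countable_supports K) L).

(** The supports of x and of the terms chosen so far are enumerated; the next
    term is taken close to x at the first n indices of each of these
    enumerations. An index in the support of x or of some term is thus
    controlled from some stage on. *)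
Theorem sigma_frechet_urysohn (b : L -> nat -> set L) :
  decreasing_bases b -> frechet_urysohn G.
Proof.
move=> [bnb bbase] A x clA.
have /choice[c cI] : forall y : G, exists c : K -> nat, inj_on c (supp y) setT.
  by move=> y; apply: card_le_inj_on; [exact: 0%N | exact: (small_supp y)].
(* N l is the neighbourhood of x from which the term following those of l is
   chosen; size l serves as the current stage. *)
pose N (l : seq G) : set G := [set z | forall y k, y \in l -> supp y k ->
  (c y k <= size l)%N -> b (x k) (size l) (z k)].
have Nx l : nbhs x (N l).
  have Ny (y : G) n : nbhs x [set z : G | forall k, supp y k ->
      (c y k <= n)%N -> b (x k) (size l) (z k)].
    have Nm (m : 'I_n.+1) : nbhs x [set z : G | forall k, supp y k ->
        c y k = m -> b (x k) (size l) (z k)].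
      have [[k [yk cym]]|nok] := pselect (exists k, supp y k /\ c y k = m).
        have : nbhs x ((fun z : G => z k) @^-1` b (x k) (size l)).
          by apply: rpower_coord_continuous; exact: open_nbhs_nbhs.
        apply: filterS => z /= bz j yj cyj.
        have [_ /(_ j k yj yk)] := cI y; rewrite cyj cym => -> //.
      by apply: filterE => z k yk cym; case: nok; exists k.
    have := filter_forall (nbhs_filter x) Nm.
    by apply: filterS => z Hz k yk ck; exact: (Hz (Ordinal (ck : (_ < n.+1)%N))).
  suff : nbhs x [set z : G | forall y, y \in l -> forall k, supp y k ->
      (c y k <= size l)%N -> b (x k) (size l) (z k)].
    by apply: filterS => z Hz y k yl; exact: Hz.
  elim: {1}l => [|y s IH]; first by apply: (@filterE _ (nbhs x)).
  apply: filterS (filterI (Ny y (size l)) IH) => z [zy zs] y'.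
  by rewrite inE => /predU1P[->//|/zs].
have /choice[a aP] : forall l, exists z, A z /\ N l z.
  by move=> l; have [z [Az Nz]] := clA _ (Nx l); exists z.
(* l n lists x and the first n terms of the sequence, latest first. *)
pose l := fix l n := if n is n'.+1 then a (l n') :: l n' else [:: x].
have size_l n : size (l n) = n.+1 by elim: n => //= n ->.
have x_l n : x \in l n by elim: n => [|n IH] /=; rewrite inE ?eqxx ?IH ?orbT.
have a_l m n : (m < n)%N -> a (l m) \in l n.
  elim: n => // n IH; rewrite ltnS leq_eqVlt => /predU1P[->|/IH mn] /=.
    exact: mem_head.
  by rewrite inE mn orbT.
exists (a \o l); first by move=> n; have [] := aP (l n).
apply/rpower_cvgP => k U xU.
have conv y m : (forall n, (m <= n)%N -> y \in l n) -> supp y k ->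
    \forall n \near \oo, U (a (l n) k).
  move=> yl yk; have [p pU] := bbase _ _ xU.
  exists (maxn m (maxn p (c y k))) => // n /=; rewrite !geq_max => /and3P[mn pn cn].
  have [_ Nn] := aP (l n).
  apply: (pU (size (l n))); first by rewrite size_l leqW.
  by apply: Nn yk _; [exact: yl | rewrite size_l leqW].
have [xk|xk] := pselect (x k = 1); last by apply: (conv x 0%N).
have [[m amk]|all1] := pselect (exists m, supp (a (l m)) k).
  by apply: (conv (a (l m)) m.+1) => // n; exact: a_l.
exists 0%N => // n _ /=; have -> : a (l n) k = x k.
  by rewrite xk; apply: contrapT => ank; apply: all1; exists n.
exact: nbhs_singleton.
Qed.

End FrechetUrysohn.

Section Character.
Variables (K : choiceType) (I : support_ideal K) (L : topologicalGroupType).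
Local Notation G := (restricted_power I L).
Variable b : L -> nat -> set L.
Hypothesis bP : decreasing_bases b.

Definition cylinder (x : G) (s : seq (K * nat)) : set G :=
  [set z | forall p, p \in s -> b (x p.1) p.2 (z p.1)].

Lemma cylinder_open_nbhs x s : open_nbhs x (cylinder x s).
Proof.
have [bnb _] := bP.
split; last by move=> p _; have [] := bnb (x p.1) p.2.
elim: s => [|p s IH].
  by rewrite (_ : cylinder _ _ = setT); [exact: openT|apply/seteqP; split].
rewrite (_ : cylinder _ _ =
    (fun z : G => z p.1) @^-1` b (x p.1) p.2 `&` cylinder x s).
  apply: openI IH; apply: open_comp => [z _|]; first exact: rpower_coord_continuous.
  by have [] := bnb (x p.1) p.2.
apply/seteqP; split=> [z Hz|z [Hp Hs] q].
  by split=> [|q qs]; apply: Hz; rewrite ?mem_head // inE qs orbT.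
by rewrite inE => /predU1P[->|/Hs].
Qed.

(** By the description of convergence in a restricted power, a filter converges
    as soon as it contains the cylinders with a single constraint. *)
Lemma cylinder_local_basis x : local_basis x (range (cylinder x)).
Proof.
split; first by move=> _ [s _ <-]; exact: cylinder_open_nbhs.
have FF : Filter (filter_from (range (cylinder x)) id).
  apply: filter_from_filter; first by exists (cylinder x [::]); exists [::].
  move=> _ _ [s _ <-] [t _ <-]; exists (cylinder x (s ++ t)); first by eexists.
  by move=> z Hz; split=> p ps; apply: Hz; rewrite mem_cat ps ?orbT.
apply/rpower_cvgP => k U xU; have [n nU] := bP.2 _ _ xU.
exists (cylinder x [:: (k, n)]); first by exists [:: (k, n)].
by move=> z /(_ _ (mem_head _ _)); exact: nU.
Qed.

(** A local basis indexed by T gives |K| <= |T| aleph_0 only. As K is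
    uncountable, T must be infinite, and the factor aleph_0 is absorbed. *)
Lemma rpower_character (g : L) : hausdorff_space L -> g <> 1 ->
  ~ countable [set: K] -> has_character G K.
Proof.
move=> hL g1 Kunc; split.
  move=> x; exists (range (cylinder x)); first exact: cylinder_local_basis.
  apply: card_le_trans (card_image_le _ _) _.
  by apply: seq_card_le => /finite_set_countable.
move=> T /(_ 1) [B [B1 Bbase] BT].
(* E U is the set of coordinates restricted by U, as witnessed by the elements
   with the single nontrivial coordinate g. *)
pose E U := [set k | ~ U (update k 1 g : G)].
have Efin U : B U -> exists c : K -> nat, inj_on c (E U) setT.
  move=> /B1 oU1; apply: card_le_inj_on; first exact: 0%N.
  have /(cylinder_local_basis 1).2 [_ [s _ <-] sU] := open_nbhs_nbhs oU1.
  apply: finite_set_countable; apply: (@sub_finite_set _ _ [set` map fst s]).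
    move=> k Uk /=; apply: contrapT => ks; apply: Uk; apply: sU => p ps.
    rewrite update_other; first by have [] := bP.1 ((1 : G) p.1) p.2.
    by move=> pk; apply: ks; rewrite -pk map_f.
  exact: finite_seq.
have Ecover k : exists U, B U /\ E U k.
  have /hausdorff_spaceE/(_ _ _ g1)[P [Q [oP oQ Pg Q1 PQ]]] := hL.
  have /Bbase[U BU UQ] : nbhs (1 : G) ((fun z : G => z k) @^-1` Q).
    by apply: rpower_coord_continuous; exact: open_nbhs_nbhs.
  exists U; split=> // /UQ; rewrite /preimage /mkset update_same => Qg.
  by have : set0 g by rewrite -PQ.
have [U UP] := choice Ecover.
have [k0 _] : [set: K] !=set0.
  by apply: infinite_setN0 => /finite_set_countable.
have [T0|/set0P[t0 _]] := eqVneq [set: T] set0.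
  by move: BT; rewrite T0 card_le0 => /eqP B0; have [] := UP k0; rewrite B0.
have [j [_ jI]] := card_le_inj_on t0 BT.
have /choice[c cP] : forall V, exists c : K -> nat, B V -> inj_on c (E V) setT.
  move=> V; have [/Efin[c cP]|NV] := pselect (B V); last by exists (fun=> 0%N).
  by exists c.
have KT : [set: K] #<= [set: T * nat].
  apply: (@inj_on_card_le _ _ (fun k => (j (U k), c (U k) k))); split=> // k l _ _.
  have [BUk EUk] := UP k; have [BUl EUl] := UP l.
  move=> [/(jI _ _ BUk BUl) UU]; rewrite -UU in EUl *.
  by have [_ cI] := cP _ BUk; exact: cI.
have Tinf : infinite_set [set: T].
  move=> /finite_set_countable cT; apply: Kunc; apply: sub_countable KT _.
  by rewrite -setXTT; apply: countableX.
apply: card_le_trans KT _.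
apply: card_le_trans (@seq_card_le {classic T} Tinf).
by apply: (@inj_on_card_le _ _ (fun p => [:: p])); split=> // p q _ _ [].
Qed.

End Character.

(** * Three by three matrices *)

Section Mx3.
Local Open Scope ring_scope.
Variable F : comNzRingType.

(** Entries by rows, so that matrix identities reduce to scalar ones. *)
Definition mx3 (a b c d e f g h i : F) : 'M[F]_3 :=
  \matrix_(j < 3, k < 3)
    nth 0 (nth [::] [:: [:: a; b; c]; [:: d; e; f]; [:: g; h; i]] j) k.

Lemma ord3P (P : 'I_3 -> Prop) : P 0 -> P 1 -> P 2 -> forall i, P i.
Proof.
move=> P0 P1 P2 [[|[|[|]]] //= h].
- by have -> : Ordinal h = 0 by exact: val_inj.
- by have -> : Ordinal h = 1 by exact: val_inj.
- by have -> : Ordinal h = 2 by exact: val_inj.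
Qed.

Lemma mx3E (A : 'M[F]_3) :
  A = mx3 (A 0 0) (A 0 1) (A 0 2) (A 1 0) (A 1 1) (A 1 2) (A 2 0) (A 2 1) (A 2 2).
Proof. by apply/matrixP; elim/ord3P; elim/ord3P; rewrite !mxE. Qed.

Lemma sum3 (f : 'I_3 -> F) : \sum_j f j = f 0 + f 1 + f 2.
Proof.
rewrite !big_ord_recr big_ord0 /= add0r.
by congr (f _ + f _ + f _); exact: val_inj.
Qed.

Lemma mx3_inj a b c d e f g h i a' b' c' d' e' f' g' h' i' :
  mx3 a b c d e f g h i = mx3 a' b' c' d' e' f' g' h' i' ->
  [/\ [/\ a = a', b = b' & c = c'], [/\ d = d', e = e' & f = f']
    & [/\ g = g', h = h' & i = i']].
Proof.
move=> /matrixP E; split; split.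
- by have := E 0 0; rewrite !mxE.
- by have := E 0 1; rewrite !mxE.
- by have := E 0 2; rewrite !mxE.
- by have := E 1 0; rewrite !mxE.
- by have := E 1 1; rewrite !mxE.
- by have := E 1 2; rewrite !mxE.
- by have := E 2 0; rewrite !mxE.
- by have := E 2 1; rewrite !mxE.
- by have := E 2 2; rewrite !mxE.
Qed.

Lemma mx3_1 : 1%:M = mx3 1 0 0 0 1 0 0 0 1.
Proof. by rewrite [LHS]mx3E !mxE. Qed.

Lemma mx3T a b c d e f g h i :
  (mx3 a b c d e f g h i)^T = mx3 a d g b e h c f i.
Proof. by rewrite [LHS]mx3E !mxE. Qed.

Lemma mx3M a b c d e f g h i a' b' c' d' e' f' g' h' i' :
  mx3 a b c d e f g h i *m mx3 a' b' c' d' e' f' g' h' i' =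
  mx3 (a*a'+b*d'+c*g') (a*b'+b*e'+c*h') (a*c'+b*f'+c*i')
      (d*a'+e*d'+f*g') (d*b'+e*e'+f*h') (d*c'+e*f'+f*i')
      (g*a'+h*d'+i*g') (g*b'+h*e'+i*h') (g*c'+h*f'+i*i').
Proof. by rewrite [LHS]mx3E !mxE !sum3 !mxE. Qed.

Lemma det_mx3 a b c d e f g h i :
  \det (mx3 a b c d e f g h i) =
  a * (e * i - f * h) - b * (d * i - f * g) + c * (d * h - e * g).
Proof.
rewrite (expand_det_row _ 0) sum3 /cofactor.
rewrite !(expand_det_row _ 0) !big_ord_recr !big_ord0 /cofactor !det_mx11.
rewrite !mxE /=.
ring.
Qed.
End Mx3.

(** * The rotation group SO(3) *)

Section Rotations.
Local Open Scope ring_scope.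
Variable R : realType.

Record rotation := Rotation {
  rot_mx :> 'M[R]_3;
  rotP : (rot_mx *m rot_mx^T == 1%:M) && (\det rot_mx == 1) }.

HB.instance Definition _ := [isSub for rot_mx].
HB.instance Definition _ := [Choice of rotation by <:].

Lemma rot_mulmxT (A : rotation) : A *m A^T = 1%:M.
Proof. by have /andP[/eqP] := rotP A. Qed.

Lemma rot_mulTmx (A : rotation) : A^T *m A = 1%:M.
Proof. exact/mulmx1C/rot_mulmxT. Qed.

Lemma rot_det (A : rotation) : \det A = 1.
Proof. by have /andP[_ /eqP] := rotP A. Qed.

Fact rot_one_subproof :
  (1%:M *m 1%:M^T == 1%:M :> 'M[R]_3) && (\det (1%:M : 'M[R]_3) == 1).
Proof. by rewrite trmx1 mulmx1 det1 !eqxx. Qed.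

Fact rot_inv_subproof (A : rotation) : (A^T *m A^T^T == 1%:M) && (\det A^T == 1).
Proof. by rewrite trmxK rot_mulTmx det_tr rot_det !eqxx. Qed.

Fact rot_mul_subproof (A B : rotation) :
  (A *m B *m (A *m B)^T == 1%:M) && (\det (A *m B) == 1).
Proof.
rewrite trmx_mul mulmxA -(mulmxA _ _ B^T) rot_mulmxT mulmx1 rot_mulmxT.
by rewrite det_mulmx !rot_det mulr1 !eqxx.
Qed.

Definition rot_one := Rotation rot_one_subproof.
Definition rot_inv A := Rotation (rot_inv_subproof A).
Definition rot_mul A B := Rotation (rot_mul_subproof A B).

Lemma rot_mulA : associative rot_mul.
Proof. by move=> A B C; apply: val_inj; exact: mulmxA. Qed.
Lemma rot_mul1 : left_id rot_one rot_mul.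
Proof. by move=> A; apply: val_inj; exact: mul1mx. Qed.
Lemma rot_mul1r : right_id rot_one rot_mul.
Proof. by move=> A; apply: val_inj; exact: mulmx1. Qed.
Lemma rot_mulV : left_inverse rot_one rot_inv rot_mul.
Proof. by move=> A; apply: val_inj; exact: rot_mulTmx. Qed.
Lemma rot_mulVr : right_inverse rot_one rot_inv rot_mul.
Proof. by move=> A; apply: val_inj; exact: rot_mulmxT. Qed.

HB.instance Definition _ := isGroup.Build rotation
  rot_mulA rot_mul1 rot_mul1r rot_mulV rot_mulVr.

HB.instance Definition _ := Topological.copy rotation (initial_topology rot_mx).

Lemma mx_cvgP m n (F : set_system 'M[R]_(m, n)) (M : 'M[R]_(m, n)) : Filter F ->
  (forall i j, (fun A : 'M_(m, n) => A i j) @ F --> M i j) -> F --> M.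
Proof.
move=> FF H U [P MP PU]; apply: filterS PU _.
apply: (@filter_forall _ _ _ F) => i; apply: (@filter_forall _ _ _ F) => j.
exact/H/MP.
Qed.

Lemma rot_cvgP (F : set_system rotation) (A : rotation) : Filter F ->
  F --> A <-> forall i j, (fun B : rotation => B i j) @ F --> A i j.
Proof.
move=> FF; rewrite -[F --> A]/(F --> (A : initial_topology _)) cvg_initialP.
split=> [FA i j|FA]; last exact: mx_cvgP.
exact: cvg_trans (cvg_app (fun B : 'M_3 => B i j) FA)
  (@coord_continuous R 3 3 i j A).
Qed.

Lemma entry_continuous i j : continuous (fun A : rotation => A i j).
Proof. by move=> A; have /rot_cvgP := @cvg_id _ (nbhs A); apply. Qed.

Lemma rot_continuousP (T : topologicalType) (f : T -> rotation) :
  (forall i j, continuous (fun t => f t i j)) -> continuous f.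
Proof. by move=> fc t; apply/rot_cvgP => i j; exact: fc. Qed.

Lemma rot_mul_continuous :
  continuous (fun z : rotation * rotation => (z.1 * z.2)%g : rotation).
Proof.
apply: rot_continuousP => i j.
have -> : (fun t : rotation * rotation => (t.1 * t.2)%g i j) =
    (fun t : rotation * rotation =>
      t.1 i 0 * t.2 0 j + t.1 i 1 * t.2 1 j + t.1 i 2 * t.2 2 j).
  by apply/funext => t; rewrite [LHS]mxE sum3.
have c1 k l : continuous (fun t : rotation * rotation => t.1 k l).
  move=> t; apply: (@cvg_comp _ _ _ fst (fun A : rotation => A k l) _ (nbhs t.1)).
    exact: cvg_fst.
  exact: entry_continuous.
have c2 k l : continuous (fun t : rotation * rotation => t.2 k l).
  move=> t; apply: (@cvg_comp _ _ _ snd (fun A : rotation => A k l) _ (nbhs t.2)).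
    exact: cvg_snd.
  exact: entry_continuous.
by move=> t; do !apply: cvgD; apply: cvgM; (exact: c1 || exact: c2).
Qed.

Lemma rot_inv_continuous : continuous (fun A : rotation => (A^-1)%g : rotation).
Proof.
apply: rot_continuousP => i j.
have -> : (fun A : rotation => (A^-1)%g i j) = (fun A : rotation => A j i).
  by apply/funext => A; rewrite [LHS]mxE.
exact: entry_continuous.
Qed.

HB.instance Definition _ :=
  Group_isTopologicalGroup.Build rotation rot_mul_continuous rot_inv_continuous.

Lemma rot_hausdorff : hausdorff_space rotation.
Proof.
move=> A B AB; apply: val_inj; apply/matrixP => i j.
apply: (@Rhausdorff R) => U V UA VB.
have [C [UC VC]] := AB _ _ (entry_continuous UA) (entry_continuous VB).
by exists (C i j).
Qed.

Lemma rot_bases : exists b : rotation -> nat -> set rotation, decreasing_bases b.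
Proof.
exists (fun A n => rot_mx @^-1` (ball (A : 'M[R]_3) n.+1%:R^-1)°); split.
  move=> A n; split.
    exists (ball (A : 'M[R]_3) n.+1%:R^-1)° => //; exact: open_interior.
  by apply: nbhsx_ballx; rewrite invr_gt0.
move=> A U [_ [[W oW <-] WA] WU].
have /nbhs_ballP[e /= e0 eW] : nbhs (A : 'M[R]_3) W by exact: open_nbhs_nbhs.
move: e0 eW => /posnumP[{}e] eW; have [n _ ne] := near_infty_natSinv_lt e.
exists n => m nm B /interior_subset AB; apply: WU; apply: eW.
by apply: le_ball AB; apply: ltW; exact: ne.
Qed.

End Rotations.

(** * Plane rotations *)

Section Givens.
Local Open Scope ring_scope.
Variable R : realType.
Implicit Types (c s t x y : R).

Lemma circle_angle c s : c ^+ 2 + s ^+ 2 = 1 ->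
  exists2 t : R, t \in `[- pi, pi] & cos t = c /\ sin t = s.
Proof.
move=> cs1; have c1 : -1 <= c <= 1 by apply/andP; split; nra.
have [a0 api] := (acos_ge0 c1, acos_lepi c1).
have cosa : cos (acos c) = c by apply: acosK; rewrite in_itv.
have sina : sin (acos c) = `|s|.
  by rewrite sin_acos // -sqrtr_sqr; congr Num.sqrt; lra.
have [s0|/ltW s0] := leP 0 s.
  by exists (acos c); rewrite ?in_itv /= ?sina ?ger0_norm //; lra.
exists (- acos c); first by rewrite in_itv /=; lra.
by rewrite cosN sinN sina ler0_norm // opprK.
Qed.

Lemma polar x y : exists2 t : R, t \in `[- pi, pi] &
  x = Num.sqrt (x ^+ 2 + y ^+ 2) * cos t /\ y = Num.sqrt (x ^+ 2 + y ^+ 2) * sin t.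
Proof.
set r := Num.sqrt _; have r2 : r ^+ 2 = x ^+ 2 + y ^+ 2.
  by rewrite sqr_sqrtr // addr_ge0 // sqr_ge0.
have [r0|rN0] := eqVneq r 0.
  exists 0; first by rewrite in_itv /= oppr_le0 pi_ge0.
  rewrite r0 expr0n /= in r2; rewrite r0 !mul0r; split; nra.
have [|t tpi [ct st]] := @circle_angle (x / r) (y / r).
  by rewrite !expr_div_n -mulrDl -r2 divff // expf_neq0.
by exists t => //; rewrite ct st; split; field.
Qed.

Fact turn01_subproof c s : c ^+ 2 + s ^+ 2 = 1 ->
  let A := mx3 c (- s) 0 s c 0 0 0 1 in (A *m A^T == 1%:M) && (\det A == 1).
Proof.
move=> cs /=; rewrite mx3T mx3M mx3_1 det_mx3; apply/andP; split; apply/eqP.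
  by congr mx3; lra.
by lra.
Qed.

Fact turn02_subproof c s : c ^+ 2 + s ^+ 2 = 1 ->
  let A := mx3 c 0 (- s) 0 1 0 s 0 c in (A *m A^T == 1%:M) && (\det A == 1).
Proof.
move=> cs /=; rewrite mx3T mx3M mx3_1 det_mx3; apply/andP; split; apply/eqP.
  by congr mx3; lra.
by lra.
Qed.

Fact turn12_subproof c s : c ^+ 2 + s ^+ 2 = 1 ->
  let A := mx3 1 0 0 0 c (- s) 0 s c in (A *m A^T == 1%:M) && (\det A == 1).
Proof.
move=> cs /=; rewrite mx3T mx3M mx3_1 det_mx3; apply/andP; split; apply/eqP.
  by congr mx3; lra.
by lra.
Qed.

(** The digits name the coordinate plane in which the rotation by t acts. *)
Definition turn01 t := Rotation (turn01_subproof (cos2Dsin2 t)).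
Definition turn02 t := Rotation (turn02_subproof (cos2Dsin2 t)).
Definition turn12 t := Rotation (turn12_subproof (cos2Dsin2 t)).

Lemma turn_continuous :
  [/\ continuous turn01, continuous turn02 & continuous turn12].
Proof.
have cs : continuous (fun t : R => - sin t).
  by move=> t; apply: cvgN; exact: continuous_sin.
have [cc ss] := (@continuous_cos R, @continuous_sin R).
have cst (k : R) : continuous (fun _ : R => k) by move=> t; exact: cvg_cst.
split; apply: rot_continuousP; elim/ord3P; elim/ord3P;
  under eq_fun do rewrite /= mxE /=;
  by [exact: cc | exact: ss | exact: cs | exact: cst].
Qed.

(** Two plane rotations move the first column of A to the first basis vector.
    The remaining rotation fixes this vector, so it acts in the plane of the
    last two coordinates. *)
Lemma turn_decomposition (A : rotation R) : exists t1 t2 t3 : R,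
  [/\ t1 \in `[- pi, pi], t2 \in `[- pi, pi], t3 \in `[- pi, pi]
    & A = (turn01 t1 * turn02 t2 * turn12 t3)%g].
Proof.
have [t1 t1pi [a1 d1]] := polar (A 0 0) (A 1 0).
set r := Num.sqrt _ in a1 d1.
(* The first column of A has norm 1; r is the norm of its first two entries. *)
have norm1 : r ^+ 2 + A 2 0 ^+ 2 = 1.
  rewrite sqr_sqrtr ?addr_ge0 ?sqr_ge0 //.
  have /(congr1 (fun M : 'M_3 => M 0 0)) := rot_mulTmx A.
  by rewrite !mxE sum3 !mxE /= mulr1n => E; rewrite -[RHS]E; ring.
have [t2 t2pi [c2 s2]] := circle_angle norm1.
pose B := ((turn02 t2)^-1 * ((turn01 t1)^-1 * A))%g.
have Bcol : [/\ B 0 0 = 1, B 1 0 = 0 & B 2 0 = 0].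
  have cs1 := cos2Dsin2 t1.
  have E i : B i 0 = (turn02 t2)^T i 0 * (cos t1 * A 0 0 + sin t1 * A 1 0)
     + (turn02 t2)^T i 1 * (- sin t1 * A 0 0 + cos t1 * A 1 0)
     + (turn02 t2)^T i 2 * A 2 0.
    by rewrite [LHS]mxE sum3; congr (_ * _ + _ * _ + _ * _);
      rewrite mxE sum3 !mxE /=; ring.
  rewrite !E !mxE /= c2 s2.
  have -> : cos t1 * A 0 0 + sin t1 * A 1 0 = r.
    rewrite a1 d1; transitivity (r * (cos t1 ^+ 2 + sin t1 ^+ 2)); first by ring.
    by rewrite cs1 mulr1.
  have -> : - sin t1 * A 0 0 + cos t1 * A 1 0 = 0.
    by rewrite a1 d1; ring.
  by split; [rewrite -norm1; ring | ring | ring].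
have [t3 t3pi BE] : exists2 t3, t3 \in `[- pi, pi] & B = turn12 t3.
  have [b00 b10 b20] := Bcol; have BE := mx3E B.
  have dB := rot_det B; have oB := rot_mulmxT B.
  rewrite BE b00 b10 b20 det_mx3 in dB.
  rewrite BE b00 b10 b20 mx3T mx3M mx3_1 in oB.
  have [[r1 _ _] [_ r2 r12] [_ _ r3]] := mx3_inj oB.
  have b01 : B 0 1 = 0 by nra.
  have b02 : B 0 2 = 0 by nra.
  (* (B11 - B22)^2 + (B12 + B21)^2 = 2 - 2 det = 0 for an orthogonal block of
     determinant 1. *)
  have b12 : B 1 2 = - B 2 1.
    by have := sqr_ge0 (B 1 1 - B 2 2); nra.
  have b22 : B 2 2 = B 1 1.
    by have := sqr_ge0 (B 1 2 + B 2 1); nra.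
  have [|t3 t3pi [c3 s3]] := @circle_angle (B 1 1) (B 2 1); first by nra.
  exists t3 => //; apply: val_inj.
  rewrite [LHS]BE b00 b10 b20 b01 b02 b12 b22 -c3 -s3 //.
exists t1, t2, t3; split=> //.
by rewrite -BE /B; rewrite !mulgA mulgK mulgV mul1g.
Qed.

Lemma rotation_compact : compact [set: rotation R].
Proof.
have [c1 c2 c3] := turn_continuous.
pose arc : set R := [set` `[- pi, pi]].
have arc_compact : compact arc by exact: segment_compact.
have turn_compact (f : R -> rotation R) : continuous f -> compact (f @` arc).
  move=> fc; apply: continuous_compact => //.
  by apply: continuous_subspaceT => ?; exact: fc.
pose mul (z : rotation R * rotation R) := (z.1 * z.2)%g : rotation R.
have mul_compact (P Q : set (rotation R)) :
    compact P -> compact Q -> compact (mul @` (P `*` Q)).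
  move=> cP cQ; apply: continuous_compact; last exact: compact_setX.
  by apply: continuous_subspaceT => ?; exact: mulg_continuous.
have := mul_compact _ _ (mul_compact _ _ (turn_compact _ c1) (turn_compact _ c2))
  (turn_compact _ c3).
congr compact; apply/seteqP; split=> // A _.
have [t1 [t2 [t3 [t1pi t2pi t3pi ->]]]] := turn_decomposition A.
exists ((turn01 t1 * turn02 t2)%g, turn12 t3) => //; split=> /=; last by exists t3.
by exists (turn01 t1, turn02 t2) => //; split; [exists t1 | exists t2].
Qed.

(** The factors of a decomposition into plane rotations are introduced one
    after the other, letting the angle vary from 0. *)
Lemma rotation_connected : connected [set: rotation R].
Proof.
have [c1 c2 c3] := turn_continuous.
suff <- : connected_component [set: rotation R] 1%g = setT.
  exact: component_connected.
apply/seteqP; split=> // A _.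
have path (f : R -> rotation R) (B C : rotation R) s t : continuous f ->
    connected_component setT (B * f s * C)%g (B * f t * C)%g.
  move=> fc; exists (range (fun u => B * f u * C)%g); last by exists t.
  split=> //.
  apply: connected_continuous_connected; last first.
    apply: continuous_subspaceT; apply: (continuous_mulg (f := fun u => B * f u)%g).
      by apply: continuous_mulg => //; exact: cst_continuous.
    exact: cst_continuous.
  by apply/connected_intervalP.
have turn0 : [/\ turn01 0 = 1%g, turn02 0 = 1%g & turn12 0 = 1%g].
  by split; apply: val_inj; rewrite /= cos0 sin0 oppr0 -mx3_1.
have [z1 z2 z3] := turn0.
have [t1 [t2 [t3 [_ _ _ ->]]]] := turn_decomposition A.
apply: (connected_component_trans (y := turn01 t1)).
  by have := path _ 1%g 1%g 0 t1 c1; rewrite z1 !mul1g !mulg1.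
apply: (connected_component_trans (y := (turn01 t1 * turn02 t2)%g)).
  by have := path _ (turn01 t1) 1%g 0 t2 c2; rewrite z2 !mulg1.
by have := path _ (turn01 t1 * turn02 t2)%g 1%g 0 t3 c3; rewrite z3 !mulg1.
Qed.

(** A matrix that commutes with the quarter turns in the planes 01 and 12 is
    scalar, and the only scalar rotation in odd dimension is the identity. *)
Lemma rotation_centerless (A : rotation R) :
  A <> 1%g -> exists B : rotation R, (A * B)%g <> (B * A)%g.
Proof.
move=> A1; apply: contrapT => /forallNP AC; apply: A1.
have {}AC (B : rotation R) : A *m B = B *m A by have /contrapT/(congr1 val) := AC B.
have dA := rot_det A; have oA := rot_mulmxT A; have AE := mx3E A.
have := AC (turn01 (pi / 2)); have := AC (turn12 (pi / 2)).
rewrite /= cos_pihalf sin_pihalf AE !mx3M.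
move=> /mx3_inj[[e1 e2 e3] [e4 e5 e6] [e7 e8 e9]].
move=> /mx3_inj[[f1 f2 f3] [f4 f5 f6] [f7 f8 f9]].
have a01 : A 0 1 = 0 by lra.
have a02 : A 0 2 = 0 by lra.
have a10 : A 1 0 = 0 by lra.
have a12 : A 1 2 = 0 by lra.
have a20 : A 2 0 = 0 by lra.
have a21 : A 2 1 = 0 by lra.
have a11 : A 1 1 = A 0 0 by lra.
have a22 : A 2 2 = A 0 0 by lra.
rewrite AE a01 a02 a10 a12 a20 a21 a11 a22 det_mx3 in dA.
rewrite AE a01 a02 a10 a12 a20 a21 a11 a22 mx3T mx3M mx3_1 in oA.
have [[g1 _ _] _ _] := mx3_inj oA.
have a00 : A 0 0 = 1 by nra.
by apply: val_inj; rewrite [LHS]AE a01 a02 a10 a12 a20 a21 a11 a22 a00 -mx3_1.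
Qed.
Lemma quarter_turn_neq1 : turn12 (pi / 2) <> 1%g.
Proof.
move=> /(congr1 (fun A : rotation R => A 1 1)).
by rewrite !mxE /= cos_pihalf => /esym/eqP; rewrite oner_eq0.
Qed.

End Givens.

Theorem corollary6p7 (K : Type) (K_uncountable : ~ countable [set: K]) :
  exists G : topologicalGroupType,
    [/\ hausdorff_space G, frechet_urysohn G, minimal_group G & has_character G K]
    /\ [/\ open (identity_component G),
           is_normal_subgroup (identity_component G)
         & omega_bounded (identity_component G)]
    /\ locally_precompact G.
Proof.
pose L : topologicalGroupType := rotation Rdefinitions.R.
have hL : hausdorff_space L := @rot_hausdorff _.
have cL : compact [set: L] := @rotation_compact _.
have [b bP] := rot_bases Rdefinitions.R.
pose G : topologicalGroupType :=
  restricted_power (countable_supports {classic K}) L.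
have idG : identity_component G = setT.
  apply: connected_component_id => //.
  exact: rpower_connected (@rotation_connected _).
exists G; split; last split.
- split.
  + exact: rpower_hausdorff.
  + exact: sigma_frechet_urysohn bP.
  + exact: rpower_minimal hL cL (@rotation_centerless _).
  + exact: (@rpower_character {classic K} _ L b bP _ hL
      (@quarter_turn_neq1 _) K_uncountable).
- split.
  + by rewrite idG; exact: openT.
  + by rewrite idG.
  + apply: omega_bounded_subspaceT => //; exact: sigma_omega_bounded.
- exact: rpower_locally_precompact.
Qed.
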